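(* Let $n$ be a positive integer with $n\equiv 0\pmod{12}$ and let $k$ be an integer with $1\le k\le\frac n2$. Let $\Gamma_{\mathrm{III}}^k(n,\mathbf 1)$ be the graph whose vertices are all Type III codes of length $n$ containing the all-ones vector $\mathbf 1$, two vertices being joined by an edge if and only if they are $k$-neighbors. Then: (a) the number of vertices of $\Gamma_{\mathrm{III}}^k(n,\mathbf 1)$ is $2\prod_{i=1}^{\frac n2-2}(3^i+1)$; (b) $\Gamma_{\mathrm{III}}^k(n,\mathbf 1)$ is regular of degree $$\frac{\prod_{i=0}^{k-1}\left(3^{\,n-2-i}-3^{\frac n2-1}\right)}{\prod_{j=0}^{k-1}\left(3^{\frac n2}-3^{\frac n2-1-j}\right)};$$ (c) the number of edges of $\Gamma_{\mathrm{III}}^k(n,\mathbf 1)$ is $$\left(\prod_{i=1}^{\frac n2-2}(3^i+1)\right)\frac{\prod_{i=0}^{k-1}\left(3^{\,n-2-i}-3^{\frac n2-1}\right)}{\prod_{j=0}^{k-1}\left(3^{\frac n2}-3^{\frac n2-1-j}\right)}.$$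
   Context: Equip $\mathbb{F}_3^n$ with the inner product $u\cdot v=\sum_{i=1}^n u_iv_i$. A code of length $n$ over $\mathbb{F}_3$ is a linear subspace $C\subseteq\mathbb{F}_3^n$; its dual is $C^\perp=\{v\in\mathbb{F}_3^n : u\cdot v=0 \text{ for all } u\in C\}$, and $C$ is self-dual if $C=C^\perp$ (so $\dim C=n/2$). The weight of a vector is its number of nonzero coordinates. A Type III code is a self-dual code over $\mathbb{F}_3$ in which every codeword has weight divisible by $3$. $\mathbf 1=(1,\dots,1)$. Codes are counted as subspaces (not up to equivalence). Two self-dual codes $C,D$ of length $n$ are $k$-neighbors if $\dim(C\cap D)=\frac n2-k$. *)

(* Defs.v *)
From HB Require Import structures.
From mathcomp Require Import all_boot all_order all_algebra.

Set Implicit Arguments.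
Unset Strict Implicit.
Unset Printing Implicit Defensive.

Import GRing.Theory VectorInternalTheory.
Local Open Scope ring_scope.

(* Equality on {vspace vT} is equality of subspaces, so cardinals over this   *)
(* finite type count subspaces, not up to equivalence.                        *)
HB.instance Definition _ (F : finFieldType) (vT : vectType F) :=
  [Countable of {vspace vT} by <:].
HB.instance Definition _ (F : finFieldType) (vT : vectType F) :=
  [Finite of {vspace vT} by <:].

Definition code (n : nat) := {vspace 'rV['F_3]_n}.

Definition dot n (u v : 'rV['F_3]_n) : 'F_3 := \sum_(i < n) u 0 i * v 0 i.

Definition weight n (v : 'rV['F_3]_n) : nat := #|[set i | v 0 i != 0]|.

Definition ones n : 'rV['F_3]_n := const_mx 1.

Definition dual n (C : code n) : {set 'rV['F_3]_n} :=
  [set v | [forall u, (u \in C) ==> (dot u v == 0)]].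

Definition self_dual n (C : code n) : bool := [set v | v \in C] == dual C.

Definition typeIII n (C : code n) : bool :=
  self_dual C && [forall v, (v \in C) ==> (3 %| weight v)%N].

(* dim (C :&: D) = n/2 - k, written without truncated subtraction; it is only *)
(* used on self-dual codes, for which n is even.                              *)
Definition kneighbors n (k : nat) (C D : code n) : bool :=
  (\dim (C :&: D)%VS + k)%N == n./2.

Definition vertices n : {set code n} := [set C | typeIII C && (ones n \in C)].

Definition neighborhood n (k : nat) (C : code n) : {set code n} :=
  [set D in vertices n | kneighbors k C D].

(* Edges are unordered pairs {C, D}.                                          *)
Definition edges n (k : nat) : {set {set code n}} :=
  [set [set C; D] | C in vertices n, D in neighborhood k C].

(* Main.v *)
Require Import Defs.
From mathcomp Require Import all_boot all_order all_algebra all_field.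
From mathcomp Require Import ring zify.

Set Implicit Arguments.
Unset Strict Implicit.
Unset Printing Implicit Defensive.

Import GRing.Theory.
Local Open Scope ring_scope.

(** Write [d] for [n./2].  Over 'F_3 the square of a nonzero coordinate is 1,
    so [dot v v] is the weight of [v] modulo 3 and every self-dual code is of
    Type III: the vertices are the self-dual codes through the all-ones vector
    (lemma [verticesE]).

    Everything else is double counting of pairs (x, D), where D is a self-dual
    code and x a vector of D.  It is carried out for the self-dual codes that
    contain a given subspace U of a self-dual code C, so that an induction can
    enlarge U; the theorem is the case where U is the line of ones.  Three
    facts make it work.

    - For x isotropic, [C :&: orth <[x]> + <[x]>] is again self-dual: it is the
      neighbor of C through x.  If x is orthogonal to U, this neighbor contains
      U + <[x]>; and if D is self-dual and x lies in D but not in C, then D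
      meets it in C :&: D + <[x]>, one dimension more than D meets C.  So
      asking D to contain x turns the count for (U, C, k.+1) into the count for
      (U + <[x]>, neighbor of C, k).
    - The number of isotropic x in the orthogonal of U that lie outside C
      depends only on dim U: it is 3 ^ (n - dim U - 1) - 3 ^ (d - 1).  Indeed,
      for x outside C, the norm [dot x x + 2 * dot x c] of the translate x + c
      is equidistributed in 'F_3 when c runs through C; so a third of the
      vectors of [orth U] outside C are isotropic ([card_isotropic_outside]).
    - Each D that meets C in dimension d - k contains exactly
      3 ^ d - 3 ^ (d - k) vectors outside C, all of them isotropic.

    Hence the number of D at distance k from C above U satisfies a recurrence
    whose successive factors are those of the numerator and the denominator of
    the degree formula ([card_at_distance]).  Counting instead the vectors of D
    outside U gives the recurrence N_s = (3 ^ (d - s - 1) + 1) * N_(s + 1) for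
    the number N_s of self-dual codes above a U of dimension s
    ([card_self_dual_above]), which starts only if there is some self-dual code
    to begin with: for 4 dividing n there is the row space of (I | H) with
    [H *m H^T = -1], and its neighbor through ones contains ones, which is
    isotropic because 3 divides n.  The number of edges is then half the sum of
    the degrees. *)

(** * The standard bilinear form *)

Lemma dotC n (u v : 'rV['F_3]_n) : dot u v = dot v u.
Proof. by apply: eq_bigr => i _; rewrite mulrC. Qed.

Lemma dotDr n (u v w : 'rV['F_3]_n) : dot u (v + w) = dot u v + dot u w.
Proof. by rewrite -big_split; apply: eq_bigr => i _; rewrite mxE mulrDr. Qed.

Lemma dotZr n a (u v : 'rV['F_3]_n) : dot u (a *: v) = a * dot u v.
Proof. by rewrite mulr_sumr; apply: eq_bigr => i _; rewrite mxE mulrCA. Qed.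

Lemma dotDl n (u v w : 'rV['F_3]_n) : dot (u + v) w = dot u w + dot v w.
Proof. by rewrite dotC dotDr !(dotC w). Qed.

Lemma dotZl n a (u v : 'rV['F_3]_n) : dot (a *: u) v = a * dot u v.
Proof. by rewrite dotC dotZr dotC. Qed.

Lemma dot_mx n (u v : 'rV['F_3]_n) : dot u v = (u *m v^T) 0 0.
Proof. by rewrite mxE; apply: eq_bigr => i _; rewrite mxE. Qed.

(** The columns are a basis of [U], so that the coordinates of
    [v *m basis_col U] are the products of [v] with that basis. *)
Definition basis_col n (U : code n) : 'M['F_3]_(n, \dim U) :=
  (\matrix_i (vbasis U)`_i)^T.

Definition orth n (U : code n) : code n := lker (linfun (mulmxr (basis_col U))).

Arguments orth {n} U%_VS.

Lemma memv_orthP n (U : code n) v :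
  reflect {in U, forall u, dot u v = 0} (v \in orth U).
Proof.
have coordE i : (v *m basis_col U) 0 i = dot (vbasis U)`_i v.
  by rewrite dotC !mxE; apply: eq_bigr => j _; rewrite !mxE.
rewrite memv_ker lfunE /=; apply: (iffP eqP) => [v0 u /coord_vbasis-> | v0].
  rewrite dotC (_ : dot _ _ = \sum_(i < \dim U)
    coord (vbasis U) i u * dot v (vbasis U)`_i).
    by rewrite big1 // => i _; rewrite dotC -coordE v0 mxE mulr0.
  rewrite (big_morph (dot v) (@dotDr _ v) (id1 := 0)); last first.
    by rewrite -(scale0r v) dotZr mul0r.
  by apply: eq_bigr => i _; rewrite dotZr.
by apply/rowP => i; rewrite coordE mxE v0 ?vbasis_mem ?mem_nth ?size_tuple.
Qed.

(** A basis matrix has full rank, so the map whose kernel is [orth U] is onto: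
    this is the nondegeneracy of the standard form. *)
Lemma dim_orth n (U : code n) : (\dim (orth U) + \dim U = n)%N.
Proof.
have: row_full (basis_col U).
  rewrite /row_full mxrank_tr; apply: inj_row_free => a a0.
  have /freeP Ufree := basis_free (vbasisP U).
  apply/rowP => i; rewrite mxE; apply: (Ufree (fun i => a 0 i)).
  apply: etrans a0; rewrite mulmx_sum_row.
  by apply: eq_bigr => j _; rewrite rowK.
case/row_fullP=> A AK.
pose phi : 'Hom('rV_n, 'rV_(\dim U)) := linfun (mulmxr (basis_col U)).
have := limg_ker_dim phi fullv; rewrite capfv -/(orth U) dimvf /dim /= mul1n.
suff -> : (phi @: fullv)%VS = fullv by rewrite dimvf /dim /= mul1n.
apply/vspaceP => w; rewrite memvf.
apply/memv_imgP; exists (w *m A); rewrite ?memvf //.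
by rewrite lfunE /= -mulmxA AK mulmx1.
Qed.

Lemma orthP n (U V : code n) :
  reflect {in U & V, forall u v, dot u v = 0} (V <= orth U)%VS.
Proof.
apply: (iffP subvP) => [UV u v Uu /UV/memv_orthP/(_ u Uu) // | UV v Vv].
by apply/memv_orthP => u Uu; apply: UV.
Qed.

Lemma sub_orthC n (U V : code n) : (V <= orth U)%VS = (U <= orth V)%VS.
Proof. by apply/orthP/orthP => UV u v Uu Vv; rewrite dotC UV. Qed.

Lemma orthK n (U : code n) : orth (orth U) = U.
Proof.
apply/eqP; rewrite eq_sym eqEdim -sub_orthC subvv /=.
by have := dim_orth U; have := dim_orth (orth U); lia.
Qed.

Lemma orthS n (U V : code n) : (U <= V -> orth V <= orth U)%VS.
Proof. by rewrite -sub_orthC orthK. Qed.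

Lemma orthD n (U V : code n) : orth (U + V) = (orth U :&: orth V)%VS.
Proof.
apply/eqP; rewrite eqEsubv subv_cap !orthS ?addvSl ?addvSr //=.
by rewrite -sub_orthC subv_add -(sub_orthC U) -(sub_orthC V) capvSl capvSr.
Qed.

Lemma orthI n (U V : code n) : orth (U :&: V) = (orth U + orth V)%VS.
Proof. by rewrite -[RHS]orthK orthD !orthK. Qed.

Lemma memv_orth_line n (x v : 'rV['F_3]_n) :
  (v \in orth <[x]>) = (dot x v == 0).
Proof.
apply/memv_orthP/eqP => [->| xv0 u /vlineP[a ->]]; rewrite ?memv_line //.
by rewrite dotZl xv0 mulr0.
Qed.

(** * Self-dual codes *)

Lemma self_dualE n (C : code n) : self_dual C = (orth C == C).
Proof.
rewrite /self_dual eq_sym; apply/eqP/eqP => CC.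
  apply/vspaceP => v; have /setP/(_ v) := CC; rewrite !inE => <-.
  apply/memv_orthP/forallP => Cv u; first by apply/implyP=> /Cv->.
  by move=> Cu; have /implyP/(_ Cu)/eqP := Cv u.
apply/setP => v; rewrite !inE -[in RHS]CC.
apply/forallP/memv_orthP => Cv u; last by apply/implyP=> /Cv->.
by move=> Cu; have /implyP/(_ Cu)/eqP := Cv u.
Qed.

(** Nonzero elements of 'F_3 have square 1, so [dot v v] counts the support. *)
Lemma self_dual_typeIII n (C : code n) : self_dual C -> typeIII C.
Proof.
move=> sdC; rewrite /typeIII sdC; apply/forallP => v; apply/implyP => Cv.
have: dot v v = 0.
  by move: (sdC) (Cv); rewrite self_dualE => /eqP {1}<- /memv_orthP->.
have ->: dot v v = (weight v)%:R.
  rewrite /dot /weight -sum1_card natr_sum [RHS]big_mkcond /=.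
  apply: eq_bigr => i _; rewrite inE; case: (v 0 i) => -[|[|[|]]] //= lt;
  exact/val_inj.
move/(congr1 val); rewrite /= val_Fp_nat // => /eqP; by [].
Qed.

Lemma verticesE n (C : code n) :
  (C \in vertices n) = (orth C == C) && (<[ones n]> <= C)%VS.
Proof.
rewrite inE -memvE -self_dualE; congr (_ && _).
by apply/idP/idP=> [/andP[]//|]; apply: self_dual_typeIII.
Qed.

Lemma dim_self_dual n (C : code n) : orth C = C -> (\dim C).*2 = n.
Proof. by move=> CC; rewrite -addnn -[in X in (X + _)%N]CC dim_orth. Qed.

Lemma card_codewords n (U : code n) : #|[set v in U]| = (3 ^ \dim U)%N.
Proof. by rewrite cardsE card_vspace card_Fp. Qed.

(** * The neighbor of a code through an isotropic vector *)

(** When [x] is isotropic and outside the self-dual code [C], this is the only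
    self-dual code that contains [x] and meets [C] in a hyperplane of [C]. *)
Definition neighbor_through n (C : code n) x : code n :=
  (C :&: orth <[x]> + <[x]>)%VS.

Lemma line_sub_orth n (x : 'rV['F_3]_n) :
  (<[x]> <= orth <[x]>)%VS = (dot x x == 0).
Proof. by rewrite -memvE memv_orth_line. Qed.

(** Taking orthogonals exchanges sums and intersections, and the modular law
    (available because [x] is isotropic) restores the original expression. *)
Lemma orth_neighbor_through n (C : code n) x :
    orth C = C -> dot x x = 0 ->
  orth (neighbor_through C x) = neighbor_through C x.
Proof.
move=> CC /eqP; rewrite -line_sub_orth => xx.
rewrite /neighbor_through orthD orthI CC orthK capvC.
by rewrite -vspace_modr // (capvC C).
Qed.

(** The modular law: a self-dual code through [x] already lies in the
    hyperplane orthogonal to [x]. *)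
Lemma neighbor_through_cap n (C D : code n) x : orth D = D -> x \in D ->
  (neighbor_through C x :&: D = C :&: D + <[x]>)%VS.
Proof.
move=> DD xD; rewrite /neighbor_through capvC -vspace_modr -?memvE //.
rewrite capvA (capvC D) -capvA (capv_idPl (_ : D <= _)%VS) //.
by rewrite -(orthK D) orthS // DD -memvE.
Qed.

Lemma dim_add_line n (U : code n) x : x \notin U ->
  \dim (U + <[x]>) = (\dim U).+1.
Proof.
move=> xU; have x0: x != 0 by apply: contraNneq xU => ->; rewrite mem0v.
rewrite dimv_disjoint_sum ?dim_vline ?x0 ?addn1 //.
apply/eqP; rewrite -subv0; apply/subvP => v /memv_capP[Uv /vlineP[a va]].
rewrite memv0; have [a0|a0] := eqVneq a 0; first by rewrite va a0 scale0r.
by case/negP: xU; rewrite -[x](scalerK a0) -va memvZ.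
Qed.

(** * Isotropic vectors outside a self-dual code *)

(** Translation by multiples of a vector of [C] not orthogonal to [y] permutes
    the fibers of the functional [dot y] on [C], so they are equinumerous. *)
Lemma card_fiber n (C : code n) y a : orth C = C -> y \notin C ->
  (3 * #|[set c in C | dot y c == a]|)%N = #|[set c in C]|.
Proof.
move=> CC yC.
have /existsP[c0 /andP[Cc0 yc0]] : [exists c, (c \in C) && (dot y c != 0)].
  apply: contraNT yC => /existsPn none; rewrite -CC.
  apply/memv_orthP => c Cc; rewrite dotC; apply/eqP.
  by have := none c; rewrite Cc negbK.
have fiberE b : #|[set c in C | dot y c == b]| = #|[set c in C | dot y c == a]|.
  pose t := ((a - b) / dot y c0) *: c0.
  rewrite -(card_imset _ (addrI t)); apply/eq_card => c.
  apply/imsetP/idP => [[d] | ]; rewrite !inE.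
    case/andP=> Cd /eqP yd ->; rewrite rpredD ?rpredZ //=.
    by rewrite dotDr dotZr divfK // yd subrK.
  case/andP=> Cc /eqP yc; exists (c - t); rewrite ?subrKC //.
  rewrite inE rpredB ?rpredZ //= -scaleN1r dotDr !dotZr divfK // yc.
  by rewrite mulN1r opprB subrKC.
rewrite -[RHS]sum1_card (partition_big (fun c => dot y c) predT) //=.
rewrite (eq_bigr (fun=> #|[set c in C | dot y c == a]|)).
  by rewrite sum_nat_const card_Fp.
move=> b _; rewrite -(fiberE b) -sum1_card.
by apply: eq_bigl => c; rewrite !inE.
Qed.

Definition isotropic_outside n (U C : code n) : {set 'rV['F_3]_n} :=
  [set x | [&& x \in orth U, x \notin C & dot x x == 0]].

(** The set [S] of all vectors of [orth U] outside [C] is stable under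
    translation by [C]; counting the pairs (x, c) for which [c + x] is isotropic
    by [x], then by [c], shows that a third of [S] is isotropic. *)
Lemma card_isotropic_outside n (U C : code n) :
    (0 < n)%N -> orth C = C -> (U <= C)%VS ->
  (#|isotropic_outside U C| + 3 ^ (n./2 - 1) = 3 ^ (n - \dim U - 1))%N.
Proof.
move=> n_gt0 CC UC; have dC := dim_self_dual CC.
have dU := dimvS UC; have dUo := dim_orth U.
have powE : (3 ^ \dim C = 3 * 3 ^ (\dim C - 1))%N.
  by rewrite -expnS; congr expn; lia.
have CU : (C <= orth U)%VS by rewrite -CC orthS.
pose S := [set x in orth U] :\: [set x in C].
have translate c x : c \in C -> (c + x \in S) = (x \in S).
  by move=> Cc; rewrite !inE !rpredDl // (subvP CU).
have cardS : (#|S| + 3 ^ \dim C = 3 ^ (n - \dim U))%N.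
  have CUset : [set x in C] \subset [set x in orth U].
    by apply/subsetP => x; rewrite !inE => /(subvP CU).
  rewrite -card_codewords cardsD (setIidPr CUset) subnK ?subset_leq_card //.
  by rewrite card_codewords; congr (3 ^ _)%N; lia.
have count :
    (#|S| * 3 ^ (\dim C - 1) = #|isotropic_outside U C| * 3 ^ \dim C)%N.
  transitivity (\sum_(x in S) \sum_(c in C | dot (c + x) (c + x) == 0%R) 1)%N.
    rewrite -sum_nat_const; apply: eq_bigr => x; rewrite !inE => /andP[xC _].
    have := card_fiber (dot x x) CC xC; rewrite card_codewords.
    move/eqP; rewrite powE eqn_pmul2l // => /eqP <-.
    rewrite sum1dep_card; apply/eq_card => c; rewrite !inE.
    case: (boolP (c \in C)) => //= Cc.
    rewrite dotDl !dotDr.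
    have -> : dot c c = 0 by have:= Cc; rewrite -{1}CC => /memv_orthP->.
    rewrite (dotC c x).
    (* the coefficient 2 of the cross term is -1 in 'F_3 *)
    have -> : 0 + dot x c + (dot x c + dot x x) = dot x x - dot x c.
      have tri : dot x c + dot x c + dot x c = 0.
        by case: (dot x c) => -[|[|[|]]] //= ?; apply/val_inj.
      by apply/(addIr (dot x c)); rewrite subrK -[RHS]add0r -[in RHS]tri; ring.
    by rewrite subr_eq0 eq_sym.
  rewrite (exchange_big_dep (mem C)) /=; last by move=> x c _ /andP[].
  rewrite mulnC -card_codewords -sum_nat_const big_set; apply: eq_bigr => c Cc.
  rewrite sum1dep_card -[RHS](card_imset _ (addrI (- c))).
  apply/eq_card => x; rewrite inE Cc /=; apply/andP/imsetP => [[Sx qx] | [y]].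
    exists (c + x); rewrite ?addKr //.
    by have := Sx; rewrite -(translate c) // !inE => /andP[-> ->]; rewrite qx.
  rewrite inE => /and3P[Uy Cy qy] ->; rewrite addNKr qy; split => //.
  by rewrite translate ?rpredN // !inE Cy.
have -> : (n./2 = \dim C)%N by lia.
apply/eqP; rewrite -(eqn_pmul2l (isT : 0 < 3)%N) mulnDr -powE -expnS.
have -> : (n - \dim U - 1).+1 = (n - \dim U)%N by lia.
have pos : (0 < 3 ^ (\dim C - 1))%N by rewrite expn_gt0.
rewrite -cardS eqn_add2r -(eqn_pmul2r pos).
by rewrite count powE; apply/eqP; ring.
Qed.

(** * Self-dual codes at a given distance *)

Definition self_dual_above n (U : code n) : {set code n} :=
  [set D | (orth D == D) && (U <= D)%VS].

(** The subspace [U] is a parameter because the induction on the distance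
    enlarges it by one vector at each step. *)
Definition at_distance n (U C : code n) (k : nat) : {set code n} :=
  [set D in self_dual_above U | kneighbors k C D].

Arguments self_dual_above {n} U%_VS.
Arguments at_distance {n} U%_VS C%_VS k.

Lemma add_line_sub_neighbor n (U C : code n) x :
  x \in orth U -> (U <= C)%VS -> (U + <[x]> <= neighbor_through C x)%VS.
Proof.
by rewrite memvE sub_orthC => Ux UC; rewrite addvS ?subvv // subv_cap UC.
Qed.

Lemma notin_sub n (U C : code n) x :
  (U <= C)%VS -> x \notin C -> x \notin U.
Proof. by move=> /subvP UC; apply/contra/UC. Qed.

(** For [x] outside [C], a self-dual code through [x] is one step closer to the
    neighbor of [C] through [x] than to [C], by [neighbor_through_cap]. *)
Lemma at_distance_neighbor n (U C : code n) k x : x \notin C ->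
  [set D in at_distance U C k.+1 | x \in D] =
  at_distance (U + <[x]>) (neighbor_through C x) k.
Proof.
move=> xC; apply/setP => D; rewrite !inE subv_add -memvE.
case: (orth D =P D) => //= DD; case: (U <= D)%VS => //=.
rewrite andbC; case: (boolP (x \in D)) => //= xD.
rewrite /kneighbors neighbor_through_cap // dim_add_line ?addSnnS //.
by rewrite memv_cap negb_and xC.
Qed.

Lemma isotropic_self_dual n (U C D : code n) x :
    orth D = D -> (U <= D)%VS -> x \in D -> x \notin C ->
  x \in isotropic_outside U C.
Proof.
move=> DD UD Dx xC; rewrite inE xC /=.
have Dox : x \in orth D by rewrite DD.
by rewrite (subvP (orthS UD)) //=; move/memv_orthP: Dox => ->.
Qed.

(** Both sides count the pairs formed by a code [D] of [A] and a vector of [D]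
    outside [C]; such a vector is automatically isotropic and orthogonal to
    [U]. *)
Lemma count_incidences n (U C : code n) (A : {set code n}) :
    A \subset self_dual_above U ->
  (\sum_(D : code n | D \in A) (3 ^ \dim D - 3 ^ \dim (C :&: D)) =
   \sum_(x in isotropic_outside U C) #|[set D in A | x \in D]|)%N.
Proof.
move=> /subsetP AU.
transitivity (\sum_(D : code n | D \in A)
    \sum_(x in isotropic_outside U C | x \in D) 1)%N.
  apply: eq_bigr => D /AU; rewrite inE => /andP[/eqP DD UD].
  rewrite sum1dep_card -!card_codewords -cardsDS; last first.
    by apply/subsetP=> x; rewrite !inE memv_cap => /andP[].
  apply/eq_card => x; rewrite !inE memv_cap; case: (boolP (x \in D)) => xD.
    case: (boolP (x \in C)) => //= xC; last first.
      have := isotropic_self_dual DD UD xD xC.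
      by rewrite inE xC => ->.
    by rewrite !andbF.
  by rewrite !andbF.
rewrite (exchange_big_dep (mem (isotropic_outside U C))) /=; last first.
  by move=> ? ? _ /andP[].
apply: eq_bigr => x Ix; rewrite sum1dep_card; apply: eq_card => D.
by rewrite !inE; move: Ix; rewrite inE => ->.
Qed.

Lemma at_distance_rec n (U C : code n) k :
  (#|at_distance U C k.+1| * (3 ^ n./2 - 3 ^ (n./2 - k.+1)) =
  \sum_(x in isotropic_outside U C)
    #|at_distance (U + <[x]>) (neighbor_through C x) k|)%N.
Proof.
transitivity (\sum_(D : code n | D \in at_distance U C k.+1)
    (3 ^ \dim D - 3 ^ \dim (C :&: D)))%N.
  rewrite -sum_nat_const; apply: eq_bigr => D; rewrite !inE.
  case/andP=> /andP[/eqP /dim_self_dual dD _]; rewrite /kneighbors => /eqP dk.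
  by congr (3 ^ _ - 3 ^ _)%N; lia.
rewrite (@count_incidences _ U); last first.
  by apply/subsetP => D; rewrite inE => /andP[].
apply: eq_bigr => x; rewrite inE => /and3P[_ xC _].
by rewrite at_distance_neighbor.
Qed.

(** The codes have equal dimensions, so distance 0 means equality. *)
Lemma at_distance0 n (U C : code n) :
  orth C = C -> (U <= C)%VS -> at_distance U C 0 = [set C].
Proof.
move=> CC UC; apply/setP => D; rewrite !inE /kneighbors addn0.
have dC := dim_self_dual CC.
apply/andP/eqP => [[/andP[/eqP DD _] /eqP dCD] | ->]; last first.
  by rewrite CC eqxx UC capvv; split=> //; apply/eqP; lia.
have dD := dim_self_dual DD.
have CD : (C :&: D == C)%VS by rewrite eqEdim capvSl dCD /=; lia.
have DC : (C :&: D == D)%VS by rewrite eqEdim capvSr dCD /=; lia.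
by rewrite -(eqP DC) (eqP CD).
Qed.

(** Each step of [at_distance_rec] contributes the last factor of the product
    over [j], and the first factor of the product over [i] since [U] grows by
    one dimension.  If [k] exceeds [n./2 - \dim U] there is no such code, which
    the vanishing factor of index [i = n./2 - \dim U] accounts for. *)
Lemma card_at_distance n (U C : code n) k :
    (0 < n)%N -> orth C = C -> (U <= C)%VS -> (k <= n./2)%N ->
  #|at_distance U C k|%:R
    * \prod_(0 <= j < k) (3%:R ^+ n./2 - 3%:R ^+ (n./2 - 1 - j))
  = \prod_(0 <= i < k) (3%:R ^+ (n - \dim U - 1 - i) - 3%:R ^+ (n./2 - 1))
  :> rat.
Proof.
move=> n_gt0; elim: k => [|k IHk] in U C * => CC UC k_le.
  by rewrite at_distance0 // cards1 !big_geq // mulr1.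
rewrite big_nat_recr //= [RHS]big_nat_recl //= subn0.
have -> : (3%:R ^+ n./2 - 3%:R ^+ (n./2 - 1 - k) : rat)
    = (3 ^ n./2 - 3 ^ (n./2 - k.+1))%N%:R.
  rewrite natrB ?leq_exp2l ?leq_subr // !natrX.
  by congr (_ - _ ^+ _); lia.
rewrite mulrCA -natrM at_distance_rec natr_sum mulr_sumr.
have := card_isotropic_outside n_gt0 CC UC.
move/(congr1 (fun m => m%:R : rat)); rewrite natrD !natrX => <-.
rewrite addrK mulr_natl -sumr_const; apply: eq_bigr => x.
rewrite inE => /and3P[Ux xC /eqP xx].
rewrite mulrC IHk ?orth_neighbor_through ?add_line_sub_neighbor //; last first.
  exact: ltnW.
rewrite dim_add_line ?(notin_sub UC) //.
by apply: eq_bigr => i _; congr (_ ^+ _ - _); lia.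
Qed.

(** * The number of self-dual codes above a subspace *)

(** The vectors outside [U] differ from those outside [C] by the vectors of [C]
    outside [U], all isotropic. *)
Lemma card_isotropic_self n (U C : code n) : orth C = C -> (U <= C)%VS ->
  (#|isotropic_outside U U| + 3 ^ \dim U =
   #|isotropic_outside U C| + 3 ^ n./2)%N.
Proof.
move=> CC UC; have dC := dim_self_dual CC.
have -> : isotropic_outside U U =
    isotropic_outside U C :|: ([set x in C] :\: [set x in U]).
  apply/setP => x; rewrite in_setU in_setD [in RHS]inE !in_set.
  case: (boolP (x \in C)) => [xC | /(notin_sub UC) -> /=].
    rewrite andbF /= andbT; case: (boolP (x \in U)) => //= xU.
      by rewrite andbF.
    by have := isotropic_self_dual CC UC xC xU; rewrite inE xU => ->.
  by rewrite orbF.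
rewrite cardsU (_ : _ :&: _ = set0) ?cards0 ?subn0; last first.
  by apply/setP => x; rewrite !inE; case: (x \in C); rewrite ?andbF.
have UCset : [set x in U] \subset [set x in C].
  by apply/subsetP => x; rewrite !inE => /(subvP UC).
rewrite -addnA cardsDS // -(card_codewords U) subnK ?subset_leq_card //.
by rewrite card_codewords; congr (_ + 3 ^ _)%N; lia.
Qed.

Lemma card_self_dual_above_rec n (U : code n) :
  (#|self_dual_above U| * (3 ^ n./2 - 3 ^ \dim U) =
  \sum_(x in isotropic_outside U U) #|self_dual_above (U + <[x]>)|)%N.
Proof.
transitivity (\sum_(D : code n | D \in self_dual_above U)
    (3 ^ \dim D - 3 ^ \dim (U :&: D)))%N.
  rewrite -sum_nat_const; apply: eq_bigr => D; rewrite !inE.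
  case/andP=> /eqP /dim_self_dual dD /capv_idPl ->.
  by congr (3 ^ _ - _)%N; lia.
rewrite (@count_incidences _ U) //; apply: eq_bigr => x _; apply/eq_card => D.
by rewrite !inE subv_add -memvE andbA.
Qed.

(** By downward induction on [\dim U]: each [U + <[x]>] lies in the neighbor of
    [C] through [x], so the induction hypothesis applies to it.  With
    [a = 3 ^ \dim U] and [b = 3 ^ m] the recurrence amounts to
    [a * (3 * b - 1) * (b + 1) = (3 * a * b * b - a * b) + 3 * a * b - a]. *)
Lemma card_self_dual_above n (U C : code n) : (0 < n)%N ->
    orth C = C -> (U <= C)%VS ->
  #|self_dual_above U| = (\prod_(0 <= i < n./2 - \dim U) (3 ^ i + 1))%N.
Proof.
move=> n_gt0; move dU: (n./2 - \dim U)%N => m.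
elim: m => [|m IHm] in U C dU * => CC UC.
  rewrite big_geq //.
  have dC := dim_self_dual CC.
  have UeqC : U = C by apply/eqP; rewrite eqEdim UC; lia.
  apply/eqP/cards1P; exists C; apply/setP => D; rewrite !inE UeqC.
  apply/andP/eqP => [[/eqP /dim_self_dual dD CD]|->]; last by rewrite CC.
  have : (C == D)%VS by rewrite eqEdim CD /=; lia.
  by move/eqP.
have dC := dim_self_dual CC.
have pos : (0 < 3 ^ n./2 - 3 ^ \dim U)%N by rewrite subn_gt0 ltn_exp2l //; lia.
apply/eqP; rewrite -(eqn_pmul2r pos) card_self_dual_above_rec big_nat_recr //=.
rewrite (eq_bigr (fun=> \prod_(0 <= i < m) (3 ^ i + 1))%N); last first.
  move=> x; rewrite inE => /and3P[Ux xU /eqP xx].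
  apply: (IHm _ (neighbor_through C x)); last exact: add_line_sub_neighbor.
    by rewrite dim_add_line //; lia.
  exact: orth_neighbor_through.
rewrite sum_nat_const -mulnA mulnC; apply/eqP; congr muln.
have := card_isotropic_self CC UC; have := card_isotropic_outside n_gt0 CC UC.
have -> : (n - \dim U - 1 = n./2 + m)%N by lia.
have -> : (n./2 = (\dim U + m).+1)%N by lia.
rewrite !expnD !expnS subn1 /= !expnD.
have: (0 < 3 ^ m)%N by rewrite expn_gt0.
move: (3 ^ m)%N (3 ^ \dim U)%N => b a.
move: #|isotropic_outside U C| #|isotropic_outside U U| => i j.
move=> b_gt0 iE jE.
rewrite mulnBr; apply/esym/eqP; rewrite -(eqn_add2r ((b + 1) * a)) subnK.
  by apply/eqP; nia.
by rewrite leq_mul2l; apply/orP; right; nia.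
Qed.

(** * Edges *)

Lemma kneighborsC n k (C D : code n) : kneighbors k C D = kneighbors k D C.
Proof. by rewrite /kneighbors capvC. Qed.

(** Each edge is the set of ends of exactly two arcs, as no code is its own
    [k]-neighbor when [0 < k]. *)
Lemma card_edges n k : (0 < k)%N ->
  (#|edges n k| * 2 = \sum_(C in vertices n) #|neighborhood k C|)%N.
Proof.
move=> k_gt0.
have nbhdE (C D : code n) :
  (D \in neighborhood k C) = (D \in vertices n) && kneighbors k C D.
  exact: in_set.
pose arcs := [set p : code n * code n |
  [&& p.1 \in vertices n, p.2 \in vertices n & kneighbors k p.1 p.2]].
have arcsE (C D : code n) : ((C, D) \in arcs) =
  [&& C \in vertices n, D \in vertices n & kneighbors k C D].
  exact: in_set.
pose ends (p : code n * code n) := [set p.1; p.2].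
have arc_neq C D : (C, D) \in arcs -> C != D.
  rewrite arcsE verticesE => /and3P[/andP[/eqP/dim_self_dual dC _] _].
  by apply: contraTneq => <-; rewrite /kneighbors capvv; lia.
have edgesE : edges n k = ends @: arcs.
  apply/setP => e; apply/imset2P/imsetP => [[C D VC] | [[C D]]].
    by rewrite nbhdE => /andP[VD CD] ->; exists (C, D); rewrite // arcsE VC VD.
  by rewrite arcsE => /and3P[VC VD CD] ->; exists C D; rewrite // nbhdE VD.
transitivity #|arcs|; last first.
  rewrite -sum1_card (partition_big fst (mem (vertices n))) /=; last first.
    by case=> C D; rewrite arcsE => /and3P[].
  apply: eq_bigr => C VC; rewrite sum1dep_card.
  rewrite -(card_imset (neighborhood k C) (_ : injective (pair C))); last first.
    by move=> ? ? [].
  apply/eq_card => -[C' D]; rewrite in_set arcsE /=.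
  apply/idP/imsetP => [/andP[/and3P[_ VD CD] /eqP CC']|[E]].
    by rewrite CC' in CD *; exists D; rewrite // nbhdE VD.
  by rewrite nbhdE => /andP[VE CE] [-> ->]; rewrite VC VE CE eqxx.
rewrite -[RHS]sum1_card (partition_big ends (mem (edges n k))) /=; last first.
  by move=> p Ap; rewrite edgesE imset_f.
rewrite -sum_nat_const; apply: eq_bigr => e; rewrite edgesE.
case/imsetP=> -[C D] CD ->; rewrite sum1dep_card.
have CneqD := arc_neq _ _ CD.
have DC : (D, C) \in arcs.
  by move: CD; rewrite !arcsE kneighborsC => /and3P[-> -> ->].
have -> : [set p | (p \in arcs) && (ends p == ends (C, D))] =
    [set (C, D); (D, C)].
  apply/setP => -[C' D']; rewrite in_set in_set2 !xpair_eqE.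
  apply/andP/orP => [[CD' /eqP E] | [] /andP[/eqP -> /eqP ->]]; last 2 first.
  - by rewrite CD.
  - by rewrite DC /ends setUC.
  have CneqD' := arc_neq _ _ CD'.
  have: C' \in ends (C, D) by rewrite -E !inE eqxx.
  have: D' \in ends (C, D) by rewrite -E !inE eqxx orbT.
  rewrite !inE /= => /orP[] /eqP E1 /orP[] /eqP E2; rewrite E1 E2 !eqxx; auto;
  by rewrite E1 E2 eqxx in CneqD'.
by rewrite cards2 xpair_eqE negb_and CneqD.
Qed.

(** * Existence of a vertex *)

Lemma dot_row_mx n m (u1 v1 : 'rV['F_3]_n) (u2 v2 : 'rV_m) :
  dot (row_mx u1 u2) (row_mx v1 v2) = dot u1 v1 + dot u2 v2.
Proof. by rewrite !dot_mx tr_row_mx mul_row_col mxE. Qed.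

Lemma dot_delta n i (v : 'rV['F_3]_n) : dot (delta_mx 0 i) v = v 0 i.
Proof. by rewrite dot_mx -rowE !mxE. Qed.

(** The code is the row space of [(1 | H)].  Also [H^T *m H = - 1], so a vector
    [(a | b)] orthogonal to all [(u | u *m H)], that is, with
    [a + b *m H^T = 0], satisfies [b = a *m H]. *)
Lemma self_dual_of_matrix m (H : 'M['F_3]_m) :
  H *m H^T = - 1%:M -> exists C : code (m + m), orth C = C.
Proof.
move=> HH.
have HTH : H^T *m H = - 1%:M.
  have: (- H) *m H^T = 1%:M by rewrite mulNmx HH opprK.
  by move/mulmx1C; rewrite mulmxN => <-; rewrite opprK.
pose phi : 'Hom('rV['F_3]_m, 'rV_(m + m)) := linfun (mulmxr (row_mx 1%:M H)).
exists (limg phi).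
have memC a b : (row_mx a b \in limg phi) = (b == a *m H).
  apply/memv_imgP/eqP => [[u _] | ->].
    rewrite lfunE /= mul_mx_row mulmx1 => /eq_row_mx[-> ->] //.
  by exists a; rewrite ?memvf // lfunE /= mul_mx_row mulmx1.
apply/vspaceP => v; rewrite -[v]hsubmxK memC.
set a := lsubmx v; set b := rsubmx v.
have dotE u : dot (row_mx u (u *m H)) (row_mx a b) = dot u (a + b *m H^T).
  by rewrite dot_row_mx dotDr !dot_mx trmx_mul trmxK mulmxA.
apply/memv_orthP/eqP => [ab | bE u].
  have: a + b *m H^T = 0.
    apply/rowP => i; rewrite [RHS]mxE -dot_delta -dotE ab //.
    by rewrite memC.
  move/(congr1 (fun w => w *m H)).
  rewrite mulmxDl -mulmxA HTH mul0mx mulmxN mulmx1.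
  by move/eqP; rewrite subr_eq0 => /eqP.
rewrite -[u]hsubmxK memC => /eqP ->.
by rewrite dotE bE -mulmxA HH mulmxN mulmx1 subrr dot_mx trmx0 mulmx0 mxE.
Qed.

(** Blockwise a Hadamard matrix of order 2, with [H *m H^T = 2] and [2 = -1] in
    'F_3; the code that it yields is a sum of tetracodes. *)
Lemma hadamard_gram r :
  let H : 'M['F_3]_(r + r) := block_mx 1%:M 1%:M 1%:M (- 1%:M) in
  H *m H^T = - 1%:M.
Proof.
rewrite /= tr_block_mx raddfN /= !trmx1 mulmx_block !mulmx1 !mulmxN !mulmx1.
rewrite opprK subrr.
have -> : 1%:M + 1%:M = - 1%:M :> 'M['F_3]_r.
  apply/matrixP => i j; rewrite !mxE -mulr2n -!mulNrn -mulrnA mulnC mulrnA.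
  by congr (_ *+ _); apply/val_inj.
by rewrite (scalar_mx_block r r 1) opp_block_mx oppr0.
Qed.

(** Divisibility by 4 provides a self-dual code, divisibility by 3 makes [ones]
    isotropic, and passing to the neighbor through [ones] brings [ones] in. *)
Lemma vertex_exists n : (12 %| n)%N -> exists C : code n, C \in vertices n.
Proof.
move=> n12; have [C CC] : exists C : code n, orth C = C.
  case/dvdnP: n12 => q ->.
  have -> : (q * 12 = (3 * q + 3 * q) + (3 * q + 3 * q))%N by lia.
  exact: self_dual_of_matrix (hadamard_gram _).
exists (neighbor_through C (ones n)); rewrite verticesE addvSr.
rewrite orth_neighbor_through ?eqxx // /dot (eq_bigr (fun=> 1)).
  by rewrite sumr_const card_ord; apply/val_inj; rewrite /= val_Fp_nat //; lia.
by move=> i _; rewrite !mxE mulr1.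
Qed.

(** * Counting vertices, neighbors and edges *)

Theorem theorem6p4 (n k : nat) (n_gt0 : (0 < n)%N) (n_mod12 : (12 %| n)%N)
    (k_bounds : (1 <= k <= n./2)%N) :
  [/\ #|vertices n| = (2 * \prod_(1 <= i < n./2 - 1) (3 ^ i + 1))%N,
      (forall C : code n, C \in vertices n ->
        #|neighborhood k C|%:R =
          (\prod_(0 <= i < k) (3%:R ^+ (n - 2 - i) - 3%:R ^+ (n./2 - 1)))
          / (\prod_(0 <= j < k) (3%:R ^+ n./2 - 3%:R ^+ (n./2 - 1 - j)))
          :> rat)
    & #|edges n k|%:R =
        (\prod_(1 <= i < n./2 - 1) (3%:R ^+ i + 1))
        * ((\prod_(0 <= i < k) (3%:R ^+ (n - 2 - i) - 3%:R ^+ (n./2 - 1)))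
           / (\prod_(0 <= j < k) (3%:R ^+ n./2 - 3%:R ^+ (n./2 - 1 - j))))
        :> rat].
Proof.
have [k_gt0 k_le] := andP k_bounds.
have V_above : vertices n = self_dual_above <[ones n]>.
  by apply/setP => C; rewrite verticesE inE.
have dim_ones : \dim <[ones n]> = 1%N.
  rewrite dim_vline; case: eqP => // /rowP/(_ (Ordinal n_gt0)).
  by rewrite !mxE.
have cardV : #|vertices n| = (2 * \prod_(1 <= i < n./2 - 1) (3 ^ i + 1))%N.
  have [C] := vertex_exists n_mod12.
  rewrite verticesE => /andP[/eqP CC onesC].
  rewrite V_above (card_self_dual_above n_gt0 CC onesC) dim_ones.
  (* the factor 2 is the term [3 ^ 0 + 1], present because [1 < n./2] *)
  by rewrite big_ltn //; case/dvdnP: n_mod12 n_gt0 => q ->; lia.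
have degree C : C \in vertices n -> #|neighborhood k C|%:R =
    (\prod_(0 <= i < k) (3%:R ^+ (n - 2 - i) - 3%:R ^+ (n./2 - 1)))
    / (\prod_(0 <= j < k) (3%:R ^+ n./2 - 3%:R ^+ (n./2 - 1 - j))) :> rat.
  rewrite verticesE => /andP[/eqP CC onesC].
  have := card_at_distance n_gt0 CC onesC k_le.
  rewrite dim_ones -subnDA => <-; rewrite mulfK ?/neighborhood ?V_above //.
  rewrite prodf_seq_neq0; apply/allP => j.
  rewrite mem_index_iota => /andP[_ jk].
  rewrite subr_eq0 -!natrX Num.Theory.eqr_nat eqn_exp2l //=; lia.
split => //.
have /(congr1 (fun m => m%:R : rat)) := card_edges n k_gt0.
rewrite natrM natr_sum (eq_bigr _ degree) sumr_const.
rewrite -[X in _ = X -> _]mulr_natl cardV natrM.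
rewrite -mulrA [LHS]mulrC => /mulfI -> //.
rewrite natr_prod; congr (_ * _).
by apply: eq_bigr => i _; rewrite natrD natrX.
Qed.
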